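(* (1) The geometric Airy flow $\gamma_t=-\frac14\nabla^\perp_{e_0}H(\gamma)$ on $\mathbb{R}^3$ preserves total arc-length: for every smooth solution $\gamma:S^1\times\mathbb{R}\to\mathbb{R}^3$ with each $\gamma(\cdot,t)$ an immersion, the length of $\gamma(\cdot,t)$ is independent of $t$. (2) The normalized geometric Airy flow $$\gamma_t=-\frac18\|H(\gamma)\|^2e_0-\frac14\nabla^\perp_{e_0}H(\gamma)$$ preserves the arc-length parameter: $\|\gamma_x\|$ is independent of $t$ for every solution. (3) The normalized geometric Airy flow commutes with the vortex filament equation $\gamma_t=\frac12\gamma_x\times\gamma_{xx}$ (as flows on curves in $\mathbb{R}^3$ parametrized by arc-length).
   Context: For an immersed curve $\gamma$ in Euclidean $\mathbb{R}^3$, $e_0$ is the unit tangent, $\partial_s$ is the arc-length derivative, $H(\gamma)=(e_0)_s$ is the mean curvature vector field, and for a normal field $\xi$ along $\gamma$, $\nabla^\perp_{e_0}\xi$ is the orthogonal projection of $\xi_s$ onto the normal plane of $\gamma$. On arc-length parametrized curves, the two flows in (3) are given by the vector fields $$X(\gamma)=\tfrac12\gamma_x\times\gamma_{xx},\qquad Y(\gamma)=-\tfrac18\|H(\gamma)\|^2e_0-\tfrac14\nabla^\perp_{e_0}H(\gamma),$$ both differential expressions in $\gamma$. That the flows commute means that these vector fields on the space of arc-length parametrized curves have vanishing bracket: for every smooth $\gamma:\mathbb R\to\mathbb R^3$ with $\|\gamma_x\|=1$, the derivative of $Y$ at $\gamma$ in the direction $X(\gamma)$ equals the derivative of $X$ at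 $\gamma$ in the direction $Y(\gamma)$. *)

(* Defs.v *)
From Stdlib Require Import Reals Lra.
From Coquelicot Require Import Coquelicot.
Open Scope R_scope.

(** Euclidean [R^3], as Coquelicot's product normed module: [plus], [scal],
    [norm] and [is_derive] are the library's; [norm] is the Euclidean norm
    (lemma [norm_R3]). *)
Definition R3 : Type := (R * R * R)%type.

Definition c1 (v : R3) : R := fst (fst v).
Definition c2 (v : R3) : R := snd (fst v).
Definition c3 (v : R3) : R := snd v.

Definition dot (u v : R3) : R := c1 u * c1 v + c2 u * c2 v + c3 u * c3 v.

Definition cross (u v : R3) : R3 :=
  (c2 u * c3 v - c3 u * c2 v,
   c3 u * c1 v - c1 u * c3 v,
   c1 u * c2 v - c2 u * c1 v).

Lemma norm_R3 (v : R3) : norm v = sqrt (dot v v).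
Proof.
  destruct v as [[a b] c].
  change (sqrt (sqrt (Rabs a ^ 2 + Rabs b ^ 2) ^ 2 + Rabs c ^ 2)
          = sqrt (a * a + b * b + c * c)).
  f_equal.
  rewrite pow2_sqrt by (apply Rplus_le_le_0_compat; apply pow2_ge_0).
  rewrite !pow2_abs; ring.
Qed.

(** [Derive] is total, with an unspecified value where the derivative does not
    exist; [vderive] is only meaningful at points of differentiability. *)
Definition vderive (f : R -> R3) (x : R) : R3 :=
  (Derive (fun y => c1 (f y)) x,
   Derive (fun y => c2 (f y)) x,
   Derive (fun y => c3 (f y)) x).

Definition smooth (f : R -> R3) : Prop :=
  forall (n : nat) (x : R),
    ex_derive_n (fun y => c1 (f y)) n x /\
    ex_derive_n (fun y => c2 (f y)) n x /\
    ex_derive_n (fun y => c3 (f y)) n x.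

Definition in_itv (a b : Rbar) (x : R) : Prop := Rbar_lt a x /\ Rbar_lt x b.

(** Joint smoothness in [(x, t)] on [(a, b) x (t0, t1)]: [ex_diff_n f n x t]
    says that all iterated partial derivatives of order at most [n], in every
    order of differentiation, exist and are jointly continuous at [(x, t)]. *)
Definition smooth2 (a b t0 t1 : Rbar) (g : R -> R -> R3) : Prop :=
  forall (n : nat) (x t : R), in_itv a b x -> in_itv t0 t1 t ->
    ex_diff_n (fun y s => c1 (g y s)) n x t /\
    ex_diff_n (fun y s => c2 (g y s)) n x t /\
    ex_diff_n (fun y s => c3 (g y s)) n x t.

Definition immersed_on (a b : Rbar) (g : R -> R3) : Prop :=
  forall x : R, in_itv a b x -> vderive g x <> (0, 0, 0).

(** The arc-length derivative along [g] of a field [xi] along [g]. *)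
Definition Ds (g xi : R -> R3) (x : R) : R3 :=
  scal (/ norm (vderive g x)) (vderive xi x).

Definition e0 (g : R -> R3) : R -> R3 := Ds g g.

Definition mean_curv (g : R -> R3) : R -> R3 := Ds g (e0 g).

Definition nabla_perp (g xi : R -> R3) (x : R) : R3 :=
  minus (Ds g xi x) (scal (dot (Ds g xi x) (e0 g x)) (e0 g x)).

Definition airy_field (g : R -> R3) (x : R) : R3 :=
  scal (- (1 / 4)) (nabla_perp g (mean_curv g) x).

Definition normalized_airy_field (g : R -> R3) (x : R) : R3 :=
  plus (scal (- (1 / 8) * norm (mean_curv g x) ^ 2) (e0 g x))
       (scal (- (1 / 4)) (nabla_perp g (mean_curv g) x)).

Definition filament_field (g : R -> R3) (x : R) : R3 :=
  scal (1 / 2) (cross (vderive g x) (vderive (vderive g) x)).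

(** [g] solves [g_t = F(g)], the first variable being the curve parameter. *)
Definition solves_flow (F : (R -> R3) -> R -> R3) (a b t0 t1 : Rbar)
    (g : R -> R -> R3) : Prop :=
  forall x t : R, in_itv a b x -> in_itv t0 t1 t ->
    vderive (fun s => g x s) t = F (fun y => g y t) x.

(** Curves on [S^1 = R / 2 pi Z] are [2 pi]-periodic functions on [R]. *)
Definition periodic (g : R -> R3) : Prop :=
  forall x : R, g (x + 2 * PI) = g x.

Definition closed_length (g : R -> R3) : R :=
  RInt (fun x => norm (vderive g x)) 0 (2 * PI).

(** [zeta] is the derivative at [g] in the direction [xi] of the differential
    expression [F]. *)
Definition is_dir_derive (F : (R -> R3) -> R -> R3) (g xi zeta : R -> R3)
    : Prop :=
  forall x : R,
    is_derive (fun eps : R => F (fun y => plus (g y) (scal eps (xi y))) x)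
      0 (zeta x).

(** The bracket of [F] and [G] vanishes on smooth arc-length parametrized
    curves; both directional derivatives are required to exist. *)
Definition commute_on_arclength (F G : (R -> R3) -> R -> R3) : Prop :=
  forall g : R -> R3, smooth g -> (forall x : R, norm (vderive g x) = 1) ->
    exists zeta : R -> R3,
      is_dir_derive F g (G g) zeta /\ is_dir_derive G g (F g) zeta.

(* Main.v *)
(** Write [p = g'], [v = |p|], and [W = nabla_perp H].  Along any immersed curve
    [<e0, W> = <e0, H> = 0] and [(e0)_x = v H], so
    [<e0, W_x> = - v <H, W> = - <H, H_x>].  The speed of a curve moving with
    velocity [F] satisfies [v_t = <e0, F_x>] by symmetry of mixed partials.  For
    the Airy flow this is the exact derivative [(|H|^2 / 8)_x], whose integral
    over a period vanishes; for the normalized flow it is cancelled by the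
    tangential term.

    For the bracket, the normalized Airy field is written as an explicit function
    of the first three derivatives of the curve.  The filament field preserves
    arc length to first order, so at [|p| = 1] only few terms of its variation
    survive, and with [p, q, s] the first, second and fourth derivatives the
    difference of the two directional derivatives is a multiple of
    [q x s - <p, q x s> p + <p, s> p x q], which vanishes since [p] is a unit
    vector orthogonal to [q]. *)

Require Import Defs.
From Stdlib Require Import Reals Lra.
From Coquelicot Require Import Coquelicot.
(* Reals exports a record projection [c1]; this restores that of [R3]. *)
Import Defs.
Open Scope R_scope.

(** * Calculus of curves in [R3] *)

Lemma R3_ext (u v : R3) : c1 u = c1 v -> c2 u = c2 v -> c3 u = c3 v -> u = v.
Proof.
  destruct u as [[u1 u2] u3], v as [[v1 v2] v3]; unfold c1, c2, c3; simpl.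
  now intros -> -> ->.
Qed.

Lemma c1_plus (u v : R3) : c1 (plus u v) = c1 u + c1 v. Proof. reflexivity. Qed.
Lemma c2_plus (u v : R3) : c2 (plus u v) = c2 u + c2 v. Proof. reflexivity. Qed.
Lemma c3_plus (u v : R3) : c3 (plus u v) = c3 u + c3 v. Proof. reflexivity. Qed.
Lemma c1_minus (u v : R3) : c1 (minus u v) = c1 u - c1 v. Proof. reflexivity. Qed.
Lemma c2_minus (u v : R3) : c2 (minus u v) = c2 u - c2 v. Proof. reflexivity. Qed.
Lemma c3_minus (u v : R3) : c3 (minus u v) = c3 u - c3 v. Proof. reflexivity. Qed.
Lemma c1_scal (k : R) (v : R3) : c1 (scal k v) = k * c1 v. Proof. reflexivity. Qed.
Lemma c2_scal (k : R) (v : R3) : c2 (scal k v) = k * c2 v. Proof. reflexivity. Qed.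
Lemma c3_scal (k : R) (v : R3) : c3 (scal k v) = k * c3 v. Proof. reflexivity. Qed.
Lemma c1_cross (u v : R3) : c1 (cross u v) = c2 u * c3 v - c3 u * c2 v.
Proof. reflexivity. Qed.
Lemma c2_cross (u v : R3) : c2 (cross u v) = c3 u * c1 v - c1 u * c3 v.
Proof. reflexivity. Qed.
Lemma c3_cross (u v : R3) : c3 (cross u v) = c1 u * c2 v - c2 u * c1 v.
Proof. reflexivity. Qed.

(** [comps] keeps every [dot] and [norm] as an atom, so that relations between inner products stay
    usable by [field] and [lra]; [coords] expands inner products as well. *)
Ltac comps := repeat (rewrite c1_plus || rewrite c2_plus || rewrite c3_plus
  || rewrite c1_minus || rewrite c2_minus || rewrite c3_minus
  || rewrite c1_scal || rewrite c2_scal || rewrite c3_scal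
  || rewrite c1_cross || rewrite c2_cross || rewrite c3_cross).

Ltac coords := unfold dot; comps.

Lemma dot_comm (u v : R3) : dot u v = dot v u.
Proof. coords; ring. Qed.

Lemma dot_plus_l (u v w : R3) : dot (plus u v) w = dot u w + dot v w.
Proof. coords; ring. Qed.

Lemma dot_minus_l (u v w : R3) : dot (minus u v) w = dot u w - dot v w.
Proof. coords; ring. Qed.

Lemma dot_scal_l (k : R) (u v : R3) : dot (scal k u) v = k * dot u v.
Proof. coords; ring. Qed.

Lemma dot_scal_r (k : R) (u v : R3) : dot u (scal k v) = k * dot u v.
Proof. coords; ring. Qed.

Lemma dot_pos (v : R3) : v <> (0, 0, 0) -> 0 < dot v v.
Proof.
  intros Hv; destruct v as [[a b] c]; unfold dot, c1, c2, c3; simpl.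
  destruct (Req_dec a 0) as [->|Ha]; [destruct (Req_dec b 0) as [->|Hb];
    [destruct (Req_dec c 0) as [->|Hc]; [now contradiction Hv|]|]|]; nra.
Qed.

Lemma norm_sqr (v : R3) : norm v * norm v = dot v v.
Proof. rewrite norm_R3; apply sqrt_sqrt; coords; nra. Qed.

Lemma norm_R3_pos (v : R3) : v <> (0, 0, 0) -> 0 < norm v.
Proof. intros Hv; rewrite norm_R3; now apply sqrt_lt_R0, dot_pos. Qed.

(** Links differentiability in the normed module to the componentwise [vderive]: one direction
    composes with the linear coordinate maps, the other reassembles the curve from the standard
    basis. *)
Lemma is_derive_R3 (f : R -> R3) (x : R) (l : R3) :
  is_derive f x l <->
  is_derive (fun y => c1 (f y)) x (c1 l) /\
  is_derive (fun y => c2 (f y)) x (c2 l) /\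
  is_derive (fun y => c3 (f y)) x (c3 l).
Proof.
  split.
  - intros Hf.
    assert (L : forall c : R3 -> R, is_linear c ->
              is_derive (fun y => c (f y)) x (c l)).
    { intros c Hc.
      apply filterdiff_ext_lin with (fun y : R => c (scal y l)).
      - apply (filterdiff_comp f c (fun y : R => scal y l) c); [exact Hf|].
        now apply filterdiff_linear.
      - intros y; exact (linear_scal c Hc y l). }
    assert (L12 : is_linear (fun t : R3 => fst t)) by apply is_linear_fst.
    split; [|split]; apply L.
    + apply (is_linear_comp (fun t : R3 => fst t) (fun t : R * R => fst t));
        [exact L12 | apply is_linear_fst].
    + apply (is_linear_comp (fun t : R3 => fst t) (fun t : R * R => snd t));
        [exact L12 | apply is_linear_snd].
    + apply is_linear_snd.
  - intros (H1 & H2 & H3).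
    apply (is_derive_ext (fun y => plus (plus
       (scal (c1 (f y)) ((1, 0, 0) : R3)) (scal (c2 (f y)) ((0, 1, 0) : R3)))
       (scal (c3 (f y)) ((0, 0, 1) : R3)))).
    { intros y; apply R3_ext; coords; unfold c1, c2, c3; simpl; ring. }
    replace l with (plus (plus
       (scal (c1 l) ((1, 0, 0) : R3)) (scal (c2 l) ((0, 1, 0) : R3)))
       (scal (c3 l) ((0, 0, 1) : R3))).
    + apply @is_derive_plus; [apply @is_derive_plus|];
        now apply @is_derive_scal_l.
    + apply R3_ext; coords; unfold c1, c2, c3; simpl; ring.
Qed.

Lemma is_derive_vderive (f : R -> R3) (x : R) (l : R3) :
  is_derive f x l -> vderive f x = l.
Proof.
  rewrite is_derive_R3; intros (H1 & H2 & H3).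
  apply R3_ext; now apply is_derive_unique.
Qed.

Lemma is_derive_Rplus (f g : R -> R) (x df dg : R) :
  is_derive f x df -> is_derive g x dg ->
  is_derive (fun y => f y + g y) x (df + dg).
Proof. apply (@is_derive_plus R_AbsRing R_NormedModule). Qed.

Lemma is_derive_Rmult (f g : R -> R) (x df dg : R) :
  is_derive f x df -> is_derive g x dg ->
  is_derive (fun y => f y * g y) x (df * g x + f x * dg).
Proof. intros Hf Hg; apply (is_derive_mult f g x df dg Hf Hg Rmult_comm). Qed.

Lemma is_derive_dot (f g : R -> R3) (x : R) (df dg : R3) :
  is_derive f x df -> is_derive g x dg ->
  is_derive (fun y => dot (f y) (g y)) x (dot df (g x) + dot (f x) dg).
Proof.
  rewrite !is_derive_R3; intros (F1 & F2 & F3) (G1 & G2 & G3).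
  unfold dot.
  match goal with |- is_derive _ _ ?l => replace l with
    ((c1 df * c1 (g x) + c1 (f x) * c1 dg)
     + (c2 df * c2 (g x) + c2 (f x) * c2 dg)
     + (c3 df * c3 (g x) + c3 (f x) * c3 dg)) by ring end.
  apply is_derive_Rplus; [apply is_derive_Rplus|];
    apply is_derive_Rmult; assumption.
Qed.

Lemma is_derive_cross (f g : R -> R3) (x : R) (df dg : R3) :
  is_derive f x df -> is_derive g x dg ->
  is_derive (fun y => cross (f y) (g y)) x
    (plus (cross df (g x)) (cross (f x) dg)).
Proof.
  intros Hf Hg; apply is_derive_R3.
  apply is_derive_R3 in Hf; apply is_derive_R3 in Hg.
  destruct Hf as (F1 & F2 & F3), Hg as (G1 & G2 & G3).
  assert (A : forall a b c d a' b' c' d',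
    is_derive a x a' -> is_derive b x b' -> is_derive c x c' ->
    is_derive d x d' ->
    is_derive (fun y => a y * b y - c y * d y) x
      (a' * b x - c' * d x + (a x * b' - c x * d'))).
  { intros a b c d a' b' c' d' Ha Hb Hc Hd.
    replace (a' * b x - c' * d x + (a x * b' - c x * d'))
      with ((a' * b x + a x * b') - (c' * d x + c x * d')) by ring.
    apply (@is_derive_minus R_AbsRing R_NormedModule);
      now apply is_derive_Rmult. }
  split; [|split]; now apply A.
Qed.

Lemma is_derive_scal_R3 (k : R -> R) (f : R -> R3) (x dk : R) (df : R3) :
  is_derive k x dk -> is_derive f x df ->
  is_derive (fun y => scal (k y) (f y)) x
    (plus (scal dk (f x)) (scal (k x) df)).
Proof.
  intros Hk Hf; apply is_derive_R3; apply is_derive_R3 in Hf.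
  destruct Hf as (F1 & F2 & F3).
  split; [|split]; now apply is_derive_Rmult.
Qed.

Lemma is_derive_norm (f : R -> R3) (x : R) (df : R3) :
  f x <> (0, 0, 0) -> is_derive f x df ->
  is_derive (fun y => norm (f y)) x (dot (f x) df / norm (f x)).
Proof.
  intros Hx Hf.
  apply (is_derive_ext (fun y => sqrt (dot (f y) (f y)))).
  { intros y; now rewrite norm_R3. }
  replace (dot (f x) df / norm (f x)) with
    ((dot df (f x) + dot (f x) df) / (2 * sqrt (dot (f x) (f x)))).
  - apply (is_derive_sqrt (fun y => dot (f y) (f y))); [now apply is_derive_dot|].
    now apply dot_pos.
  - rewrite <- norm_R3, (dot_comm df); field.
    now apply Rgt_not_eq, norm_R3_pos.
Qed.

(** [Derive] only sees a neighborhood of the point, so [U] is meant to be open. *)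
Fixpoint Cn (U : R -> Prop) (n : nat) (f : R -> R) : Prop :=
  match n with
  | O => True
  | S n => (forall x, U x -> ex_derive f x) /\ Cn U n (Derive f)
  end.

Definition Cinf (U : R -> Prop) (f : R -> R) : Prop := forall n, Cn U n f.

(** * Stability of smoothness on an open set *)

Section OpenSet.
Variable U : R -> Prop.
Hypothesis openU : open U.

Lemma Derive_ext_on (f g : R -> R) :
  (forall x, U x -> f x = g x) -> forall x, U x -> Derive f x = Derive g x.
Proof.
  intros E x Hx; apply Derive_ext_loc.
  apply (filter_imp U); [exact E | now apply openU].
Qed.

Lemma Cn_ext (n : nat) (f g : R -> R) :
  (forall x, U x -> f x = g x) -> Cn U n f -> Cn U n g.
Proof.
  revert f g; induction n as [|n IH]; simpl; [trivial|].
  intros f g E [D C]; split.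
  - intros x Hx; apply (ex_derive_ext_loc f); [|now apply D].
    apply (filter_imp U); [exact E | now apply openU].
  - apply (IH (Derive f)); [now apply Derive_ext_on | exact C].
Qed.

Lemma Cn_pred (n : nat) (f : R -> R) : Cn U (S n) f -> Cn U n f.
Proof.
  revert f; induction n as [|n IH]; [simpl; trivial|].
  intros f [D C]; split; [exact D | now apply IH].
Qed.

Lemma Cn_const (n : nat) (c : R) : Cn U n (fun _ => c).
Proof.
  revert c; induction n as [|n IH]; simpl; [trivial|].
  intros c; split; [intros; apply ex_derive_const|].
  apply Cn_ext with (fun _ => 0); [|apply IH].
  intros x _; now rewrite Derive_const.
Qed.

Lemma Cn_plus (n : nat) (f g : R -> R) :
  Cn U n f -> Cn U n g -> Cn U n (fun x => f x + g x).
Proof.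
  revert f g; induction n as [|n IH]; simpl; [trivial|].
  intros f g [Df Cf] [Dg Cg]; split.
  - intros x Hx; apply @ex_derive_plus; auto.
  - apply Cn_ext with (fun x => Derive f x + Derive g x); [|now apply IH].
    intros x Hx; symmetry; apply Derive_plus; auto.
Qed.

Lemma Cn_mult (n : nat) (f g : R -> R) :
  Cn U n f -> Cn U n g -> Cn U n (fun x => f x * g x).
Proof.
  revert f g; induction n as [|n IH]; [simpl; trivial|].
  intros f g Cf Cg; pose proof (Cn_pred _ _ Cf); pose proof (Cn_pred _ _ Cg).
  destruct Cf as [Df Cf], Cg as [Dg Cg]; split.
  - intros x Hx; apply ex_derive_mult; auto.
  - apply Cn_ext with (fun x => Derive f x * g x + f x * Derive g x).
    + intros x Hx; symmetry; apply Derive_mult; auto.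
    + apply Cn_plus; now apply IH.
Qed.

Lemma Cn_inv (n : nat) (f : R -> R) :
  (forall x, U x -> f x <> 0) -> Cn U n f -> Cn U n (fun x => / f x).
Proof.
  intros Nz; revert Nz; induction n as [|n IH]; [simpl; trivial|].
  intros Nz Cf; pose proof (Cn_pred _ _ Cf) as Cf'.
  destruct Cf as [Df Cf]; split.
  - intros x Hx; apply ex_derive_inv; auto.
  (* In this product form the derivative contains [/ f x] itself, to which the induction hypothesis
     applies. *)
  - apply Cn_ext with (fun x => (-1 * Derive f x) * (/ f x * / f x)).
    + intros x Hx; rewrite Derive_inv by auto; field; auto.
    + repeat apply Cn_mult; auto using Cn_const.
Qed.

Lemma Cn_sqrt (n : nat) (f : R -> R) :
  (forall x, U x -> 0 < f x) -> Cn U n f -> Cn U n (fun x => sqrt (f x)).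
Proof.
  intros Pos; induction n as [|n IH]; [simpl; trivial|].
  intros Cf; pose proof (Cn_pred _ _ Cf) as Cf'.
  destruct Cf as [Df Cf].
  assert (D : forall x, U x -> is_derive (fun x => sqrt (f x)) x
                                 (Derive f x / (2 * sqrt (f x)))).
  { intros x Hx; apply (is_derive_sqrt f); [now apply Derive_correct, Df|auto]. }
  split.
  - intros x Hx; eexists; now apply D.
  - apply Cn_ext with (fun x => Derive f x * / (2 * sqrt (f x))).
    + intros x Hx; symmetry; now apply is_derive_unique, D.
    + apply Cn_mult; [exact Cf|]. apply Cn_inv.
      * intros x Hx; pose proof (sqrt_lt_R0 _ (Pos x Hx)); lra.
      * apply Cn_mult; auto using Cn_const.
Qed.

Definition smooth_on (f : R -> R3) : Prop :=
  Cinf U (fun x => c1 (f x)) /\ Cinf U (fun x => c2 (f x)) /\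
  Cinf U (fun x => c3 (f x)).

Lemma smooth_on_is_derive (f : R -> R3) (x : R) :
  smooth_on f -> U x -> is_derive f x (vderive f x).
Proof.
  intros (C1 & C2 & C3) Hx; apply is_derive_R3.
  split; [|split]; apply Derive_correct;
    [apply (C1 1%nat) | apply (C2 1%nat) | apply (C3 1%nat)]; exact Hx.
Qed.

Lemma smooth_on_vderive (f : R -> R3) : smooth_on f -> smooth_on (vderive f).
Proof.
  intros (C1 & C2 & C3).
  repeat split; intros n; [apply (C1 (S n)) | apply (C2 (S n)) | apply (C3 (S n))].
Qed.

Lemma smooth_on_plus (f g : R -> R3) :
  smooth_on f -> smooth_on g -> smooth_on (fun x => plus (f x) (g x)).
Proof.
  intros (F1 & F2 & F3) (G1 & G2 & G3).
  repeat split; intros n; now apply Cn_plus.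
Qed.

Lemma smooth_on_scal (k : R -> R) (f : R -> R3) :
  Cinf U k -> smooth_on f -> smooth_on (fun x => scal (k x) (f x)).
Proof.
  intros K (F1 & F2 & F3); repeat split; intros n; now apply Cn_mult.
Qed.

Lemma smooth_on_minus (f g : R -> R3) :
  smooth_on f -> smooth_on g -> smooth_on (fun x => minus (f x) (g x)).
Proof.
  intros F (G1 & G2 & G3).
  apply (smooth_on_plus f (fun x => opp (g x)) F).
  assert (A : forall k, Cinf U k -> Cinf U (fun x => - k x)).
  { intros k K n; apply Cn_ext with (fun x => -1 * k x); [intros; ring|].
    apply Cn_mult; [apply Cn_const | apply K]. }
  repeat split; now apply A.
Qed.

Lemma Cinf_dot (f g : R -> R3) :
  smooth_on f -> smooth_on g -> Cinf U (fun x => dot (f x) (g x)).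
Proof.
  intros (F1 & F2 & F3) (G1 & G2 & G3) n.
  repeat apply Cn_plus; now apply Cn_mult.
Qed.

Lemma smooth_on_cross (f g : R -> R3) :
  smooth_on f -> smooth_on g -> smooth_on (fun x => cross (f x) (g x)).
Proof.
  intros (F1 & F2 & F3) (G1 & G2 & G3).
  assert (A : forall a b c d, Cinf U a -> Cinf U b -> Cinf U c -> Cinf U d ->
             Cinf U (fun x => a x * b x - c x * d x)).
  { intros a b c d Ca Cb Cc Cd n.
    apply Cn_ext with (fun x => a x * b x + -1 * (c x * d x)); [intros; ring|].
    apply Cn_plus; repeat apply Cn_mult; auto using Cn_const. }
  repeat split; now apply A.
Qed.

Lemma Cinf_norm (f : R -> R3) :
  smooth_on f -> (forall x, U x -> f x <> (0, 0, 0)) ->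
  Cinf U (fun x => norm (f x)).
Proof.
  intros F Nz n; apply Cn_ext with (fun x => sqrt (dot (f x) (f x))).
  - intros x _; now rewrite norm_R3.
  - apply Cn_sqrt; [|now apply Cinf_dot]. intros x Hx; now apply dot_pos, Nz.
Qed.

(** * Orthogonality relations along an immersed curve *)

Section Immersion.
Variable g : R -> R3.
Hypothesis smooth_g : smooth_on g.
Hypothesis immersed_g : forall x, U x -> vderive g x <> (0, 0, 0).

Lemma speed_pos (x : R) : U x -> 0 < norm (vderive g x).
Proof. intros Hx; now apply norm_R3_pos, immersed_g. Qed.

Lemma vderive_Ds (xi : R -> R3) (x : R) :
  U x -> vderive xi x = scal (norm (vderive g x)) (Ds g xi x).
Proof.
  intros Hx; pose proof (speed_pos x Hx).
  apply R3_ext; unfold Ds; coords; field; lra.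
Qed.

Lemma smooth_on_Ds (xi : R -> R3) : smooth_on xi -> smooth_on (Ds g xi).
Proof.
  intros X; apply smooth_on_scal; [|now apply smooth_on_vderive].
  intros n; apply Cn_inv.
  - intros x Hx; now apply Rgt_not_eq, speed_pos.
  - apply Cinf_norm; [now apply smooth_on_vderive | exact immersed_g].
Qed.

Lemma smooth_on_e0 : smooth_on (e0 g).
Proof. now apply smooth_on_Ds. Qed.

Lemma smooth_on_mean_curv : smooth_on (mean_curv g).
Proof. apply smooth_on_Ds, smooth_on_e0. Qed.

Lemma smooth_on_nabla_perp (xi : R -> R3) :
  smooth_on xi -> smooth_on (nabla_perp g xi).
Proof.
  intros X; apply smooth_on_minus; [now apply smooth_on_Ds|].
  apply smooth_on_scal; [|apply smooth_on_e0].
  apply Cinf_dot; [now apply smooth_on_Ds | apply smooth_on_e0].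
Qed.

Lemma dot_e0_e0 (x : R) : U x -> dot (e0 g x) (e0 g x) = 1.
Proof.
  intros Hx; pose proof (speed_pos x Hx).
  unfold e0, Ds; rewrite dot_scal_l, dot_scal_r, <- norm_sqr; field; lra.
Qed.

(** Product rule applied to a constant inner product; it moves a derivative from one factor to the
    other and is the source of all the orthogonality relations below. *)
Lemma dot_vderive_of_const (xi eta : R -> R3) (k x : R) :
  smooth_on xi -> smooth_on eta -> (forall y, U y -> dot (xi y) (eta y) = k) ->
  U x -> dot (vderive xi x) (eta x) = - dot (xi x) (vderive eta x).
Proof.
  intros X E C Hx.
  assert (D : Derive (fun y => dot (xi y) (eta y)) x = 0).
  { rewrite (Derive_ext_on _ (fun _ => k) C x Hx); apply Derive_const. }
  assert (D' := is_derive_unique _ _ _ (is_derive_dot _ _ _ _ _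
    (smooth_on_is_derive xi x X Hx) (smooth_on_is_derive eta x E Hx))).
  pose proof (eq_trans (eq_sym D') D); lra.
Qed.

Lemma dot_mean_curv_e0 (x : R) : U x -> dot (mean_curv g x) (e0 g x) = 0.
Proof.
  intros Hx; unfold mean_curv, Ds at 1.
  pose proof (dot_vderive_of_const _ _ _ x smooth_on_e0 smooth_on_e0 dot_e0_e0 Hx)
    as E.
  rewrite dot_scal_l, E.
  (* By symmetry of [dot], [E] equates a number with its own negative. *)
  rewrite dot_comm in E; replace (dot (e0 g x) (vderive (e0 g) x)) with 0 by lra.
  ring.
Qed.

Lemma dot_nabla_perp_e0 (xi : R -> R3) (x : R) :
  U x -> dot (nabla_perp g xi x) (e0 g x) = 0.
Proof.
  intros Hx; unfold nabla_perp.
  rewrite dot_minus_l, dot_scal_l, dot_e0_e0 by exact Hx; ring.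
Qed.

Lemma dot_vderive_nabla_perp_mean_curv (x : R) : U x ->
  dot (vderive (nabla_perp g (mean_curv g)) x) (e0 g x)
  = - dot (vderive (mean_curv g) x) (mean_curv g x).
Proof.
  intros Hx.
  rewrite (dot_vderive_of_const _ _ 0 x
    (smooth_on_nabla_perp _ smooth_on_mean_curv) smooth_on_e0
    (dot_nabla_perp_e0 _) Hx).
  rewrite (vderive_Ds (e0 g)) by exact Hx; fold (mean_curv g x).
  (* The projection subtracts a multiple of [e0], which pairs to zero with the mean curvature. *)
  unfold nabla_perp; rewrite dot_scal_r, dot_minus_l, dot_scal_l.
  rewrite (dot_comm (e0 g x)), dot_mean_curv_e0 by exact Hx.
  rewrite (vderive_Ds (mean_curv g)), dot_scal_l by exact Hx; ring.
Qed.

Lemma dot_vderive_airy_field (x : R) : U x ->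
  dot (vderive (airy_field g) x) (e0 g x)
  = 1 / 4 * dot (vderive (mean_curv g) x) (mean_curv g x).
Proof.
  intros Hx.
  pose proof (is_derive_scal_R3 _ _ _ _ _ (is_derive_const (- (1 / 4)) x)
    (smooth_on_is_derive _ x (smooth_on_nabla_perp _ smooth_on_mean_curv) Hx)) as D.
  rewrite (is_derive_vderive (airy_field g) x _ D).
  rewrite dot_plus_l, !dot_scal_l, dot_vderive_nabla_perp_mean_curv by exact Hx.
  change (@zero R_NormedModule) with 0; ring.
Qed.

Lemma normalized_airy_fieldE (x : R) :
  normalized_airy_field g x
  = plus (scal (- (1 / 8) * dot (mean_curv g x) (mean_curv g x)) (e0 g x))
         (airy_field g x).
Proof.
  unfold normalized_airy_field, airy_field; do 3 f_equal.
  rewrite <- norm_sqr; simpl; ring.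
Qed.

Lemma smooth_on_airy_field : smooth_on (airy_field g).
Proof.
  apply smooth_on_scal; [intros n; apply Cn_const|].
  apply smooth_on_nabla_perp, smooth_on_mean_curv.
Qed.

(** Since $e_0$ is orthogonal to its own derivative, the tangential term contributes only
    $-\frac18(\|H\|^2)_x = -\frac14\langle H_x, H\rangle$, the opposite of the contribution of the
    Airy field. *)
Lemma dot_vderive_normalized_airy_field (x : R) : U x ->
  dot (vderive (normalized_airy_field g) x) (e0 g x) = 0.
Proof.
  intros Hx.
  assert (K := is_derive_dot _ _ _ _ _
    (smooth_on_is_derive _ x smooth_on_mean_curv Hx)
    (smooth_on_is_derive _ x smooth_on_mean_curv Hx)).
  apply (is_derive_scal _ x (- (1 / 8))) in K.
  assert (D := @is_derive_plus _ _ _ _ _ _ _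
    (is_derive_scal_R3 _ _ _ _ _ K (smooth_on_is_derive _ x smooth_on_e0 Hx))
    (smooth_on_is_derive _ x smooth_on_airy_field Hx)).
  apply (is_derive_ext _ (normalized_airy_field g)) in D;
    [|intros y; symmetry; apply normalized_airy_fieldE].
  rewrite (is_derive_vderive _ _ _ D).
  rewrite !dot_plus_l, !dot_scal_l, dot_vderive_airy_field, dot_e0_e0 by exact Hx.
  rewrite (vderive_Ds (e0 g)) by exact Hx; fold (mean_curv g x).
  rewrite dot_scal_l, dot_mean_curv_e0 by exact Hx.
  rewrite (dot_comm (mean_curv g x)); simpl; field.
Qed.

End Immersion.
End OpenSet.

(** * Evolution of the speed *)

Lemma open_in_itv (a b : Rbar) : open (in_itv a b).
Proof. apply open_and; [apply open_Rbar_gt | apply open_Rbar_lt]. Qed.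

Lemma vderive_ext_loc (f g : R -> R3) (x : R) :
  locally x (fun y => f y = g y) -> vderive f x = vderive g x.
Proof.
  intros E; apply R3_ext; apply Derive_ext_loc;
    (eapply filter_imp; [|exact E]); now intros y ->.
Qed.

(** Follows, in the tree of iterated partial derivatives, the branch that differentiates in the
    first variable only. *)
Lemma ex_diff_n_Cn (U : R -> Prop) (n : nat) (f : R -> R -> R) (t : R) :
  (forall x, U x -> ex_diff_n f n x t) -> Cn U n (fun y => f y t).
Proof.
  revert f; induction n as [|n IH]; intros f H; [exact I|]; split.
  - intros x Hx; now destruct (H x Hx) as (_ & D & _).
  - apply (IH (fun u v => Derive (fun z => f z v) u)).
    intros x Hx; now destruct (H x Hx) as (_ & _ & _ & D & _).
Qed.

Lemma locally_2d_prod (U V : R -> Prop) (x t : R) :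
  locally x U -> locally t V -> locally_2d (fun u v => U u /\ V v) x t.
Proof.
  intros [d1 H1] [d2 H2].
  assert (Hd : 0 < Rmin d1 d2) by (apply Rmin_pos; apply cond_pos).
  exists (mkposreal _ Hd); simpl; intros u v Hu Hv; split.
  - apply H1; eapply Rlt_le_trans; [exact Hu | apply Rmin_l].
  - apply H2; eapply Rlt_le_trans; [exact Hv | apply Rmin_r].
Qed.

Lemma is_derive_mixed_partial (U V : R -> Prop) (f : R -> R -> R) (x t : R) :
  open U -> open V ->
  (forall y s, U y -> V s -> ex_diff_n f 2 y s) -> U x -> V t ->
  is_derive (fun s => Derive (fun y => f y s) x) t
    (Derive (fun y => Derive (fun s => f y s) t) x).
Proof.
  intros oU oV H Hx Ht.
  (* Order two of [ex_diff_n] provides both mixed partials on the neighborhood [U] times [V] and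
     their continuity at the point. *)
  rewrite Schwarz.
  - apply Derive_correct.
    now destruct (H x t Hx Ht) as (_ & _ & _ & (_ & _ & D & _) & _).
  - apply (locally_2d_impl_strong (fun u v => U u /\ V v)).
    + apply locally_2d_forall; intros u v HUV.
      destruct (locally_2d_singleton _ _ _ HUV) as [Hu Hv].
      now destruct (H u v Hu Hv) as (_ & D1 & D2 & (_ & _ & D3 & _) & (_ & D4 & _)).
    + apply locally_2d_prod; [now apply oU | now apply oV].
  - now destruct (H x t Hx Ht) as (_ & _ & _ & _ & (_ & _ & _ & (C & _) & _)).
  - now destruct (H x t Hx Ht) as (_ & _ & _ & (_ & _ & _ & _ & (C & _)) & _).
Qed.

Section Flow.
Variables (F : (R -> R3) -> R -> R3) (a b t0 t1 : Rbar) (g : R -> R -> R3).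
Hypothesis smooth_g : smooth2 a b t0 t1 g.

Lemma smooth2_slice (t : R) :
  in_itv t0 t1 t -> smooth_on (in_itv a b) (fun y => g y t).
Proof.
  intros Ht; repeat split; intros n;
    [ apply (ex_diff_n_Cn _ n (fun y s => c1 (g y s)))
    | apply (ex_diff_n_Cn _ n (fun y s => c2 (g y s)))
    | apply (ex_diff_n_Cn _ n (fun y s => c3 (g y s))) ];
    intros x Hx; now destruct (smooth_g n x t Hx Ht) as (D1 & D2 & D3).
Qed.

(** Puts the time derivative innermost, where the flow equation can replace it by the vector
    field. *)
Lemma is_derive_velocity (x t : R) : in_itv a b x -> in_itv t0 t1 t ->
  is_derive (fun s => vderive (fun y => g y s) x) t
    (vderive (fun y => vderive (g y) t) x).
Proof.
  intros Hx Ht; apply is_derive_R3; split; [|split].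
  - apply (is_derive_mixed_partial _ _ (fun y s => c1 (g y s)) x t
      (open_in_itv a b) (open_in_itv t0 t1)); trivial.
    intros y s Hy Hs; apply smooth_g; assumption.
  - apply (is_derive_mixed_partial _ _ (fun y s => c2 (g y s)) x t
      (open_in_itv a b) (open_in_itv t0 t1)); trivial.
    intros y s Hy Hs; apply smooth_g; assumption.
  - apply (is_derive_mixed_partial _ _ (fun y s => c3 (g y s)) x t
      (open_in_itv a b) (open_in_itv t0 t1)); trivial.
    intros y s Hy Hs; apply smooth_g; assumption.
Qed.

Hypothesis immersed_g :
  forall t : R, in_itv t0 t1 t -> immersed_on a b (fun x => g x t).
Hypothesis flow_g : solves_flow F a b t0 t1 g.

Lemma is_derive_speed (x t : R) : in_itv a b x -> in_itv t0 t1 t ->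
  is_derive (fun s => norm (vderive (fun y => g y s) x)) t
    (dot (vderive (F (fun y => g y t)) x) (e0 (fun y => g y t) x)).
Proof.
  intros Hx Ht.
  assert (D := is_derive_norm (fun s => vderive (fun y => g y s) x) t _
                 (immersed_g t Ht x Hx) (is_derive_velocity x t Hx Ht)).
  replace (dot (vderive (F (fun y => g y t)) x) (e0 (fun y => g y t) x))
    with (dot (vderive (fun y => g y t) x) (vderive (fun y => vderive (g y) t) x)
          / norm (vderive (fun y => g y t) x)); [exact D|].
  (* The flow equation is known on the parameter interval only; as this is open, the equation holds
     near [x], which suffices for differentiating it. *)
  rewrite (vderive_ext_loc (fun y => vderive (g y) t)
             (F (fun y => g y t)) x).
  - unfold e0, Ds; rewrite dot_scal_r, dot_comm; apply Rmult_comm.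
  - apply (filter_imp (in_itv a b)); [|now apply open_in_itv].
    intros y Hy; now apply flow_g.
Qed.

End Flow.

Lemma in_itv_convex (a b : Rbar) (x y z : R) :
  in_itv a b x -> in_itv a b z -> x <= y <= z -> in_itv a b y.
Proof.
  intros [A _] [_ B] [Hxy Hyz]; split.
  - exact (Rbar_lt_le_trans a x y A Hxy).
  - exact (Rbar_le_lt_trans y z b Hyz B).
Qed.

Lemma is_derive_0_constant_on (a b : Rbar) (f : R -> R) (x y : R) :
  (forall z, in_itv a b z -> is_derive f z 0) ->
  in_itv a b x -> in_itv a b y -> f x = f y.
Proof.
  intros D.
  assert (L : forall u v, in_itv a b u -> in_itv a b v -> u < v -> f u = f v).
  { intros u v Hu Hv Huv.
    apply (@eq_is_derive R_NormedModule f u v); [|exact Huv].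
    intros z Hz; apply D; now apply (in_itv_convex a b u z v). }
  intros Hx Hy; destruct (Rtotal_order x y) as [H|[->|H]];
    [now apply L | reflexivity | symmetry; now apply L].
Qed.

(** * Conservation of the speed under the normalized flow *)

Lemma normalized_airy_flow_preserves_speed (a b t0 t1 : Rbar) (g : R -> R -> R3) :
  smooth2 a b t0 t1 g ->
  (forall t : R, in_itv t0 t1 t -> immersed_on a b (fun x => g x t)) ->
  solves_flow normalized_airy_field a b t0 t1 g ->
  forall x t t' : R, in_itv a b x -> in_itv t0 t1 t -> in_itv t0 t1 t' ->
    norm (vderive (fun y => g y t) x) = norm (vderive (fun y => g y t') x).
Proof.
  intros Sg Ig Fg x t t' Hx Ht Ht'.
  apply (is_derive_0_constant_on t0 t1
    (fun s => norm (vderive (fun y => g y s) x))); trivial.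
  intros s Hs.
  rewrite <- (dot_vderive_normalized_airy_field _ (open_in_itv a b)
    (fun y => g y s) (smooth2_slice _ _ _ _ _ Sg s Hs) (Ig s Hs) x Hx).
  now apply (is_derive_speed _ a b t0 t1).
Qed.

(** * Conservation of the length of closed curves *)

Lemma vderive_periodic (f : R -> R3) : periodic f -> periodic (vderive f).
Proof.
  intros P x.
  assert (D : forall c : R3 -> R,
    Derive (fun y => c (f y)) (x + 2 * PI) = Derive (fun y => c (f y)) x).
  { intros c; unfold Derive; f_equal; apply Lim_ext; intros h.
    replace (x + 2 * PI + h) with ((x + h) + 2 * PI) by ring.
    now rewrite !P. }
  unfold vderive; now rewrite !D.
Qed.

Lemma Ds_periodic (g xi : R -> R3) :
  periodic g -> periodic xi -> periodic (Ds g xi).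
Proof.
  intros G X x; unfold Ds.
  now rewrite (vderive_periodic g G x), (vderive_periodic xi X x).
Qed.

Lemma mean_curv_periodic (g : R -> R3) : periodic g -> periodic (mean_curv g).
Proof. exact (fun G => Ds_periodic g _ G (Ds_periodic g g G G)). Qed.

(** [smooth2] takes the curve parameter first, whereas differentiation under the integral sign takes
    time first. *)
Lemma continuity_2d_pt_swap (f : R -> R -> R) (x y : R) :
  continuity_2d_pt f x y -> continuity_2d_pt (fun u v => f v u) y x.
Proof.
  intros C eps; destruct (C eps) as [d Hd].
  exists d; intros u v Hu Hv; now apply Hd.
Qed.

Lemma continuity_2d_pt_norm (f : R -> R -> R3) (x y : R) :
  continuity_2d_pt (fun u v => c1 (f u v)) x y ->
  continuity_2d_pt (fun u v => c2 (f u v)) x y ->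
  continuity_2d_pt (fun u v => c3 (f u v)) x y ->
  continuity_2d_pt (fun u v => norm (f u v)) x y.
Proof.
  intros C1 C2 C3.
  apply continuity_2d_pt_ext with (fun u v => sqrt (dot (f u v) (f u v))).
  { intros u v; now rewrite norm_R3. }
  apply (continuity_1d_2d_pt_comp sqrt (fun u v => dot (f u v) (f u v))).
  - apply continuity_pt_sqrt; coords; nra.
  - unfold dot; apply continuity_2d_pt_plus; [apply continuity_2d_pt_plus|];
      apply continuity_2d_pt_mult; assumption.
Qed.

Lemma in_itv_infty (x : R) : in_itv m_infty p_infty x.
Proof. split; exact I. Qed.

(** The continuity required for differentiating the length under the integral. The time derivative
    of the speed is $\langle p, q\rangle/|p|$ with $p = \gamma_x$ and $q = \gamma_{xt}$, both
    jointly continuous. *)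
Lemma continuity_2d_pt_Derive_speed (g : R -> R -> R3) (t x : R) :
  smooth2 m_infty p_infty m_infty p_infty g ->
  (forall t : R, immersed_on m_infty p_infty (fun x => g x t)) ->
  continuity_2d_pt
    (fun u v => Derive (fun s => norm (vderive (fun y => g y s) v)) u) t x.
Proof.
  intros Sg Ig.
  pose (p := fun u v => vderive (fun y => g y u) v).
  pose (q := fun u v => vderive (fun s => vderive (fun y => g y s) v) u).
  assert (Hp : forall u v, is_derive (fun s => p s v) u (q u v)).
  { intros u v; unfold p, q.
    assert (D := is_derive_velocity _ _ _ _ g Sg v u
      (in_itv_infty v) (in_itv_infty u)).
    rewrite (is_derive_vderive (fun s => vderive (fun y => g y s) v) u _ D).
    exact D. }
  apply continuity_2d_pt_ext with
    (fun u v => dot (p u v) (q u v) * / norm (p u v)).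
  { intros u v; symmetry; apply is_derive_unique.
    apply (is_derive_norm (fun s => p s v)); [|apply Hp].
    apply Ig, in_itv_infty. }
  destruct (Sg 2%nat x t (in_itv_infty x) (in_itv_infty t)) as
    ((_ & _ & _ & (P1 & _ & _ & _ & (Q1 & _)) & _) &
     (_ & _ & _ & (P2 & _ & _ & _ & (Q2 & _)) & _) &
     (_ & _ & _ & (P3 & _ & _ & _ & (Q3 & _)) & _)).
  apply continuity_2d_pt_swap in P1; apply continuity_2d_pt_swap in P2;
  apply continuity_2d_pt_swap in P3; apply continuity_2d_pt_swap in Q1;
  apply continuity_2d_pt_swap in Q2; apply continuity_2d_pt_swap in Q3.
  apply continuity_2d_pt_mult.
  - unfold dot; apply continuity_2d_pt_plus; [apply continuity_2d_pt_plus|];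
      apply continuity_2d_pt_mult; assumption.
  - apply continuity_2d_pt_inv; [now apply continuity_2d_pt_norm|].
    apply Rgt_not_eq, norm_R3_pos, Ig, in_itv_infty.
Qed.

Lemma Cinf_continuous (U : R -> Prop) (f : R -> R) (x : R) :
  Cinf U f -> U x -> continuous f x.
Proof. intros C Hx; exact (@ex_derive_continuous R_AbsRing R_NormedModule f x (proj1 (C 1%nat) x Hx)). Qed.

Lemma airy_flow_preserves_length (g : R -> R -> R3) :
  (forall t : R, periodic (fun x => g x t)) ->
  smooth2 m_infty p_infty m_infty p_infty g ->
  (forall t : R, immersed_on m_infty p_infty (fun x => g x t)) ->
  solves_flow airy_field m_infty p_infty m_infty p_infty g ->
  forall t t' : R,
    closed_length (fun x => g x t) = closed_length (fun x => g x t').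
Proof.
  intros Pg Sg Ig Fg t t'.
  apply (is_derive_0_constant_on m_infty p_infty
    (fun s => closed_length (fun x => g x s))); try apply in_itv_infty.
  clear t t'; intros t _.
  pose (h := fun x => g x t).
  assert (Sh : smooth_on (in_itv m_infty p_infty) h)
    by (apply (smooth2_slice _ _ _ _ _ Sg), in_itv_infty).
  assert (oU := open_in_itv m_infty p_infty).
  assert (SH := smooth_on_mean_curv _ oU h Sh (Ig t)).
  (* [K] is a primitive of the rate of change [dK] of the speed. *)
  pose (K := fun x => 1 / 8 * dot (mean_curv h x) (mean_curv h x)).
  pose (dK := fun x => 1 / 4 * dot (vderive (mean_curv h) x) (mean_curv h x)).
  assert (DK : forall x, is_derive K x (dK x)).
  { intros x.
    assert (D := smooth_on_is_derive _ _ x SH (in_itv_infty x)).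
    replace (dK x) with (1 / 8 * (dot (vderive (mean_curv h) x) (mean_curv h x)
      + dot (mean_curv h x) (vderive (mean_curv h) x)))
      by (unfold dK; rewrite (dot_comm (mean_curv h x)); field).
    apply is_derive_scal, (is_derive_dot _ _ _ _ _ D D). }
  assert (CdK : forall x, continuous dK x).
  { intros x.
    apply (Cinf_continuous (in_itv m_infty p_infty)); [|apply in_itv_infty].
    intros n; apply (Cn_mult _ oU n (fun _ => 1 / 4));
      [apply Cn_const, oU|].
    apply (Cinf_dot _ oU); [now apply smooth_on_vderive | exact SH]. }
  assert (I : RInt dK 0 (2 * PI) = 0).
  { apply is_RInt_unique.
    (* The first occurrence of 0 is the lower endpoint, the second the value of the integral. *)
    replace 0 with (K (2 * PI) - K 0) at 2.
    - exact (is_RInt_derive K dK 0 (2 * PI) (fun x _ => DK x) (fun x _ => CdK x)).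
    - unfold K; rewrite <- (Rplus_0_l (2 * PI)).
      rewrite (mean_curv_periodic h (Pg t) 0); ring. }
  (* The claimed derivative 0 becomes the integral of [dK], in the form produced by differentiation
     under the integral sign; the endpoints of the length integral are hidden in [closed_length] and
     remain untouched. *)
  rewrite <- I.
  assert (DS : forall x s, is_derive (fun s => norm (vderive (fun y => g y s) x)) s
    (dot (vderive (airy_field (fun y => g y s)) x) (e0 (fun y => g y s) x))).
  { intros x s; apply (is_derive_speed _ m_infty p_infty m_infty p_infty);
      auto using in_itv_infty. }
  rewrite (RInt_ext dK
    (fun x => Derive (fun s => norm (vderive (fun y => g y s) x)) t)).
  2:{ intros x _; symmetry; apply (eq_trans (is_derive_unique _ _ _ (DS x t))).
      apply (dot_vderive_airy_field _ oU h Sh (Ig t)), in_itv_infty. }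
  apply (is_derive_RInt_param (fun s x => norm (vderive (fun y => g y s) x))).
  - apply filter_forall; intros s x _; eexists; apply DS.
  - intros x _; now apply continuity_2d_pt_Derive_speed.
  - apply filter_forall; intros s.
    apply (@ex_RInt_continuous R_CompleteNormedModule); intros x _.
    apply (Cinf_continuous (in_itv m_infty p_infty)); [|apply in_itv_infty].
    apply Cinf_norm; [exact oU | | apply Ig].
    apply smooth_on_vderive, (smooth2_slice _ _ _ _ _ Sg), in_itv_infty.
Qed.

(** * Commutation with the filament equation *)

(** The fields along a curve with first three derivatives [p], [q], [r]. *)
Definition mean_curv_jet (p q : R3) : R3 :=
  minus (scal (/ norm p ^ 2) q) (scal (dot p q * / norm p ^ 4) p).

Definition nabla_perp_jet (p q r : R3) : R3 :=
  minus (scal (/ norm p ^ 3) (minus r (scal (dot r p * / norm p ^ 2) p)))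
    (scal (3 * (dot p q * / norm p ^ 5))
       (minus q (scal (dot p q * / norm p ^ 2) p))).

Definition airy_jet (p q r : R3) : R3 :=
  plus (scal (- (1 / 8) * dot (mean_curv_jet p q) (mean_curv_jet p q))
          (scal (/ norm p) p))
       (scal (- (1 / 4)) (nabla_perp_jet p q r)).

(** * Jet formulas for the fields along an immersed curve *)

Section Jet.
Variables (U : R -> Prop) (g : R -> R3).
Hypothesis openU : open U.
Hypothesis smooth_g : smooth_on U g.
Hypothesis immersed_g : forall x, U x -> vderive g x <> (0, 0, 0).

Let p := vderive g.
Let q := vderive p.
Let r := vderive q.
Let v := fun x => norm (p x).

Lemma smooth_on_velocity : smooth_on U p.
Proof. now apply smooth_on_vderive. Qed.
Lemma smooth_on_acceleration : smooth_on U q.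
Proof. apply smooth_on_vderive, smooth_on_velocity. Qed.

Lemma is_derive_speed_param (x : R) : U x -> is_derive v x (dot (p x) (q x) / v x).
Proof.
  intros Hx; apply is_derive_norm; [now apply immersed_g|].
  apply (smooth_on_is_derive U); [apply smooth_on_velocity | exact Hx].
Qed.

Lemma mean_curvE (x : R) : U x -> mean_curv g x = mean_curv_jet (p x) (q x).
Proof.
  intros Hx; assert (Hv : 0 < v x) by now apply (speed_pos U).
  assert (D := is_derive_scal_R3 _ _ _ _ _
    (is_derive_inv _ _ _ (is_derive_speed_param x Hx) (Rgt_not_eq _ _ Hv))
    (smooth_on_is_derive U p x smooth_on_velocity Hx)).
  unfold mean_curv, Ds at 1.
  rewrite (is_derive_vderive (e0 g) x _ D); fold p q.
  unfold mean_curv_jet; change (norm (p x)) with (v x).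
  apply R3_ext; comps; field; lra.
Qed.

(** Differentiating $H = q/v^2 - a\,p$ with $a = \langle p, q\rangle/v^4$ gives $r/v^2 - 3a\,q$ up
    to a multiple of $p$: the factor 3 collects $2a\,q$ from $v^{-2}$ and $a\,q$ from $a\,p$. The
    formula is the normal part of this, divided by $v$. *)
Lemma nabla_perp_mean_curvE (x : R) : U x ->
  nabla_perp g (mean_curv g) x = nabla_perp_jet (p x) (q x) (r x).
Proof.
  intros Hx; assert (Hv : 0 < v x) by now apply (speed_pos U).
  assert (V0 : v x <> 0) by lra.
  assert (Pos : forall y, U y -> v y <> 0)
    by (intros y Hy; now apply Rgt_not_eq, (speed_pos U)).
  assert (Cv : Cinf U v) by (apply Cinf_norm; trivial; apply smooth_on_velocity).
  (* The value of [Derive a x] stays symbolic: it multiplies [p x], which the normal projection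
     removes. *)
  pose (a := fun y => dot (p y) (q y) * / v y ^ 4).
  assert (Da : is_derive a x (Derive a x)).
  { apply Derive_correct.
    assert (C : Cn U 1 a); [|now apply C].
    apply (Cn_mult U openU); [apply Cinf_dot; auto using smooth_on_velocity, smooth_on_acceleration|].
    apply (Cn_inv U openU _ (fun y => v y ^ 4));
      [intros y Hy; now apply pow_nonzero, Pos|].
    simpl pow; repeat apply (Cn_mult U openU); try apply Cv.
    apply (Cn_const U openU). }
  assert (Db : is_derive (fun y => / v y ^ 2) x
                 (- 2 * dot (p x) (q x) * / v x ^ 4)).
  { replace (- 2 * dot (p x) (q x) * / v x ^ 4) with
      (- (INR 2 * (dot (p x) (q x) / v x) * v x ^ 1) / (v x ^ 2) ^ 2)
      by (simpl; field; lra).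
    apply (is_derive_inv (fun y => v y ^ 2)); [|now apply pow_nonzero].
    apply (is_derive_pow v 2); now apply is_derive_speed_param. }
  assert (D := @is_derive_minus _ _ _ _ _ _ _
    (is_derive_scal_R3 _ _ _ _ _ Db (smooth_on_is_derive U q x smooth_on_acceleration Hx))
    (is_derive_scal_R3 _ _ _ _ _ Da (smooth_on_is_derive U p x smooth_on_velocity Hx))).
  assert (E : vderive (mean_curv g) x = vderive (fun y => minus
     (scal (/ v y ^ 2) (q y)) (scal (a y) (p y))) x).
  { apply vderive_ext_loc, (filter_imp U); [exact mean_curvE | now apply openU]. }
  rewrite (is_derive_vderive (fun y => minus
     (scal (/ v y ^ 2) (q y)) (scal (a y) (p y))) x _ D) in E.
  unfold nabla_perp, e0, Ds; rewrite E; fold p q r.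
  change (norm (p x)) with (v x); unfold nabla_perp_jet.
  change (norm (p x)) with (v x).
  rewrite !dot_scal_r, !dot_scal_l, dot_minus_l, !dot_plus_l, !dot_scal_l.
  (* Writing [dot (p x) (p x)] through the speed lets [field] see that the tangential terms
     cancel. *)
  rewrite <- (norm_sqr (p x)), (dot_comm (q x) (p x)).
  change (norm (p x)) with (v x); unfold a.
  apply R3_ext; comps; field; lra.
Qed.

Lemma normalized_airy_field_jetE (x : R) : U x ->
  normalized_airy_field g x = airy_jet (p x) (q x) (r x).
Proof.
  intros Hx; unfold normalized_airy_field, airy_jet.
  rewrite nabla_perp_mean_curvE, mean_curvE by exact Hx.
  do 3 f_equal; rewrite <- norm_sqr; simpl; ring.
Qed.

End Jet.

(** * First variation of the normalized Airy field at unit speed *)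

Lemma is_derive_inv_pow_stationary (v : R -> R) (x : R) (n : nat) :
  is_derive v x 0 -> v x = 1 -> is_derive (fun y => / v y ^ n) x 0.
Proof.
  intros D V.
  replace 0 with (- (INR n * 0 * v x ^ pred n) / (v x ^ n) ^ 2)
    by (rewrite V, !pow1; field).
  apply (is_derive_inv (fun y => v y ^ n)); [now apply is_derive_pow|].
  rewrite V, pow1; lra.
Qed.

(** The hypotheses express that [p] stays of unit length and orthogonal to [q]
    to first order. *)
Lemma is_derive_airy_jet (p q r : R -> R3) (x : R) (p0 q0 r0 p1 q1 r1 : R3) :
  p x = p0 -> q x = q0 -> r x = r0 ->
  is_derive p x p1 -> is_derive q x q1 -> is_derive r x r1 ->
  norm p0 = 1 -> dot p0 q0 = 0 ->
  dot p0 p1 = 0 -> dot p1 q0 + dot p0 q1 = 0 ->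
  is_derive (fun y => airy_jet (p y) (q y) (r y)) x
    (plus (plus (scal (- (1 / 4) * dot q0 q1) p0)
                (scal (- (1 / 8) * dot q0 q0) p1))
       (scal (- (1 / 4)) (minus r1
          (plus (scal (dot r1 p0 + dot r0 p1) p0) (scal (dot r0 p0) p1))))).
Proof.
  intros <- <- <- Dp Dq Dr Np Pq Pp1 Pq1.
  assert (Nz : p x <> (0, 0, 0)).
  { intros E; rewrite norm_R3, E in Np.
    revert Np; unfold dot, c1, c2, c3; simpl.
    rewrite !Rmult_0_l, !Rplus_0_l, sqrt_0; lra. }
  pose (v := fun y => norm (p y)).
  assert (Vx : v x = 1) by exact Np.
  assert (Dv : is_derive v x 0).
  { replace 0 with (dot (p x) p1 / norm (p x)) by (rewrite Pp1; apply Rmult_0_l).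
    now apply is_derive_norm. }
  (* The speed is stationary, hence so is each of its powers in the jet. *)
  assert (DV : forall n, is_derive (fun y => / v y ^ n) x 0)
    by (intros n; now apply is_derive_inv_pow_stationary).
  assert (DV1 : is_derive (fun y => / v y) x 0).
  { apply (is_derive_ext (fun y => / v y ^ 1)); [|apply DV].
    intros y; now rewrite pow_1. }
  assert (Dm : is_derive (fun y => dot (p y) (q y)) x 0)
    by (rewrite <- Pq1; now apply is_derive_dot).
  (* $\langle p, q\rangle$ vanishes to first order, so every term of the jet carrying it drops out
     of the variation. *)
  assert (Dmk : forall n, is_derive (fun y => dot (p y) (q y) * / v y ^ n) x 0).
  { intros n.
    replace 0 with (0 * / v x ^ n + dot (p x) (q x) * 0)
      by (rewrite Pq; ring).
    exact (is_derive_Rmult _ _ _ _ _ Dm (DV n)). }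
  (* The derivative is assembled following the shape of [airy_jet]; the normalizations enter when
     its value is compared with the claimed one. *)
  assert (DH := @is_derive_minus _ _ _ _ _ _ _
    (is_derive_scal_R3 _ _ _ _ _ (DV 2%nat) Dq)
    (is_derive_scal_R3 _ _ _ _ _ (Dmk 4%nat) Dp)).
  assert (DW := @is_derive_minus _ _ _ _ _ _ _
    (is_derive_scal_R3 _ _ _ _ _ (DV 3%nat)
      (@is_derive_minus _ _ _ _ _ _ _ Dr
        (is_derive_scal_R3 _ _ _ _ _
          (is_derive_Rmult _ _ _ _ _ (is_derive_dot _ _ _ _ _ Dr Dp) (DV 2%nat))
          Dp)))
    (is_derive_scal_R3 _ _ _ _ _ (is_derive_scal _ _ 3 _ (Dmk 5%nat))
      (@is_derive_minus _ _ _ _ _ _ _ Dq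
        (is_derive_scal_R3 _ _ _ _ _ (Dmk 2%nat) Dp)))).
  assert (D := @is_derive_plus _ _ _ _ _ _ _
    (is_derive_scal_R3 _ _ _ _ _
      (is_derive_scal _ _ (- (1 / 8)) _ (is_derive_dot _ _ _ _ _ DH DH))
      (is_derive_scal_R3 _ _ _ _ _ DV1 Dp))
    (is_derive_scal_R3 _ _ _ _ _ (is_derive_const (- (1 / 4)) x) DW)).
  match type of D with is_derive _ _ ?l =>
    match goal with |- is_derive _ _ ?l' => replace l' with l end end;
    [exact D|].
  change (@zero R_NormedModule) with 0.
  rewrite Vx, Pq, !pow1, Rinv_1.
  apply R3_ext; coords; field.
Qed.

Lemma cross_of_orthogonal_unit (p q s : R3) : dot p p = 1 -> dot p q = 0 ->
  cross q s = minus (scal (dot p (cross q s)) p) (scal (dot p s) (cross p q)).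
Proof.
  intros Pp Pq.
  (* [(p x w) x p = |p|^2 w - <p, w> p] with [w = q x s], and
     [p x w = <p, s> q - <p, q> s] *)
  assert (E : scal (dot p p) (cross q s) = minus (minus
    (scal (dot p (cross q s)) p) (scal (dot p s) (cross p q)))
    (scal (dot p q) (cross s p))) by (apply R3_ext; coords; ring).
  rewrite Pp, Pq in E.
  apply R3_ext; [apply (f_equal c1) in E | apply (f_equal c2) in E
                | apply (f_equal c3) in E]; revert E; comps; lra.
Qed.

(** * Linear perturbations of a curve *)

Lemma is_derive_eq (f : R -> R3) (x : R) (l l' : R3) :
  is_derive f x l -> l = l' -> is_derive f x l'.
Proof. now intros D <-. Qed.

Lemma is_derive_scal_const (k : R) (f : R -> R3) (x : R) (df : R3) :
  is_derive f x df -> is_derive (fun y => scal k (f y)) x (scal k df).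
Proof.
  intros D.
  apply (is_derive_eq _ _ _ _
    (is_derive_scal_R3 _ _ _ _ _ (is_derive_const k x) D)).
  change (@zero R_NormedModule) with 0; apply R3_ext; comps; ring.
Qed.

Lemma is_derive_line (u w : R3) (x : R) :
  is_derive (fun e => plus u (scal e w)) x w.
Proof.
  apply (is_derive_eq _ _ _ _ (@is_derive_plus _ _ _ _ _ _ _
    (is_derive_const u x)
    (is_derive_scal_R3 _ _ _ _ _ (is_derive_id x) (is_derive_const w x)))).
  change (@one R_AbsRing) with 1.
  apply R3_ext; comps; change (c1 zero) with 0;
    change (c2 zero) with 0; change (c3 zero) with 0; ring.
Qed.

Lemma vderive_plus_scal (f h f' h' : R -> R3) (e : R) :
  (forall y, is_derive f y (f' y)) -> (forall y, is_derive h y (h' y)) ->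
  forall x, vderive (fun y => plus (f y) (scal e (h y))) x
            = plus (f' x) (scal e (h' x)).
Proof.
  intros F H x; apply is_derive_vderive.
  apply @is_derive_plus; [apply F | apply is_derive_scal_const, H].
Qed.

Lemma vderive_ext (f g : R -> R3) (x : R) :
  (forall y, f y = g y) -> vderive f x = vderive g x.
Proof. intros E; now apply vderive_ext_loc, filter_forall. Qed.

Lemma dot_pos_neq_0 (v : R3) : 0 < dot v v -> v <> (0, 0, 0).
Proof. intros H ->; revert H; unfold dot, c1, c2, c3; simpl; lra. Qed.

(** A perturbed curve may have points of zero velocity, so the jet formulas are applied where its
    velocity is nonzero; this gives openness of that set, in the curve parameter and in the
    perturbation parameter alike. *)
Lemma open_dot_pos (f f' : R -> R3) :
  (forall y, is_derive f y (f' y)) -> open (fun y => 0 < dot (f y) (f y)).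
Proof.
  intros F; apply (open_comp (fun y => dot (f y) (f y)) (fun z => 0 < z)).
  - intros y _.
    apply (@ex_derive_continuous R_AbsRing R_NormedModule
      (fun y => dot (f y) (f y)) y).
    eexists; apply is_derive_dot; apply F.
  - apply open_gt.
Qed.

Lemma Cinf_of_ex_derive_n (U : R -> Prop) (f : R -> R) :
  (forall n x, ex_derive_n f n x) -> Cinf U f.
Proof.
  intros H n; change f with (Derive_n f 0); generalize 0%nat as k.
  induction n as [|n IH]; intros k; [exact I|split].
  - intros x _; exact (H (S k) x).
  - exact (IH (S k)).
Qed.

Lemma smooth_smooth_on (U : R -> Prop) (g : R -> R3) : smooth g -> smooth_on U g.
Proof.
  intros S; repeat split; apply Cinf_of_ex_derive_n; intros n x;
    now destruct (S n x) as (S1 & S2 & S3).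
Qed.

Lemma Cn_mono (U V : R -> Prop) (n : nat) (f : R -> R) :
  (forall x, V x -> U x) -> Cn U n f -> Cn V n f.
Proof.
  intros UV; revert f; induction n as [|n IH]; [trivial|].
  intros f [D C]; split; auto.
Qed.

Lemma smooth_on_mono (U V : R -> Prop) (f : R -> R3) :
  (forall x, V x -> U x) -> smooth_on U f -> smooth_on V f.
Proof.
  intros UV (F1 & F2 & F3).
  repeat split; intros n; now apply (Cn_mono U V).
Qed.

(** Here [p] to [w] stand for the first five derivatives of the curve, [X1] to [X3] for derivatives
    of the filament field and [Y1], [Y2] for those of the Airy field. The left side is the variation
    of the Airy field along the filament field, the right side the reverse; the terms in $p\times w$
    and $p\times r$ cancel, and the difference is $-\frac38$ times the relation of
    [cross_of_orthogonal_unit]. *)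
Lemma airy_filament_bracket_identity (p q r s w : R3) :
  dot p p = 1 -> dot p q = 0 -> dot p r = - dot q q -> dot p s = - 3 * dot q r ->
  let X1 := scal (1 / 2) (cross p r) in
  let X2 := scal (1 / 2) (plus (cross q r) (cross p s)) in
  let X3 := scal (1 / 2) (plus (scal 2 (cross q s)) (cross p w)) in
  let Y1 := plus (plus (scal (- (3 / 4) * dot q r) p)
      (scal (- (3 / 8) * dot q q) q)) (scal (- (1 / 4)) s) in
  let Y2 := plus (plus (plus (scal (- (3 / 4) * (dot r r + dot q s)) p)
      (scal (- (3 / 2) * dot q r) q)) (scal (- (3 / 8) * dot q q) r))
      (scal (- (1 / 4)) w) in
  plus (plus (scal (- (1 / 4) * dot q X2) p) (scal (- (1 / 8) * dot q q) X1))
    (scal (- (1 / 4)) (minus X3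
       (plus (scal (dot X3 p + dot r X1) p) (scal (dot r p) X1))))
  = scal (1 / 2) (plus (cross Y1 q) (cross p Y2)).
Proof.
  intros Pp Pq Pr Ps X1 X2 X3 Y1 Y2.
  assert (E := cross_of_orthogonal_unit p q s Pp Pq); rewrite Ps in E.
  (* The antisymmetry of the triple product reduces all inner products with [X1], [X2], [X3] to
     $\langle p, q\times s\rangle$ or zero. *)
  replace (dot q X2) with (- (1 / 2) * dot p (cross q s))
    by (unfold X2; coords; ring).
  replace (dot X3 p) with (dot p (cross q s)) by (unfold X3; coords; field).
  replace (dot r X1) with 0 by (unfold X1; coords; ring).
  rewrite (dot_comm r p), Pr.
  unfold X1, X3, Y1, Y2.
  apply R3_ext; [apply (f_equal c1) in E | apply (f_equal c2) in E
                | apply (f_equal c3) in E]; revert E; comps; lra.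
Qed.

(** * Curves parametrized by arc length *)

Section Arclength.
Variable g : R -> R3.
Hypothesis smooth_g : smooth g.
Hypothesis arclength_g : forall x, norm (vderive g x) = 1.

Let p := vderive g.
Let q := vderive p.
Let r := vderive q.
Let s := vderive r.
Let w := vderive s.
Let T : R -> Prop := fun _ => True.

Lemma arclength_smooth :
  smooth_on T g /\ smooth_on T p /\ smooth_on T q /\ smooth_on T r /\
  smooth_on T s.
Proof.
  assert (G := smooth_smooth_on T g smooth_g).
  assert (P := smooth_on_vderive T g G).
  assert (Q := smooth_on_vderive T p P).
  assert (Rr := smooth_on_vderive T q Q).
  assert (S := smooth_on_vderive T r Rr).
  tauto.
Qed.

Lemma arclength_derivatives (x : R) :
  is_derive g x (p x) /\ is_derive p x (q x) /\ is_derive q x (r x) /\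
  is_derive r x (s x) /\ is_derive s x (w x).
Proof.
  destruct arclength_smooth as (G & P & Q & Rr & S).
  split; [|split; [|split; [|split]]];
    apply (smooth_on_is_derive T); trivial; exact I.
Qed.

Lemma arclength_dot_p_p (x : R) : dot (p x) (p x) = 1.
Proof. rewrite <- norm_sqr; unfold p; rewrite arclength_g; ring. Qed.

Lemma arclength_dot_p_q (x : R) : dot (p x) (q x) = 0.
Proof.
  destruct arclength_smooth as (_ & P & _).
  assert (E := dot_vderive_of_const T open_true p p 1 x P P
    (fun y _ => arclength_dot_p_p y) I).
  fold q in E; rewrite dot_comm in E; lra.
Qed.

Lemma arclength_dot_p_r (x : R) : dot (p x) (r x) = - dot (q x) (q x).
Proof.
  destruct arclength_smooth as (_ & P & Q & _).
  assert (E := dot_vderive_of_const T open_true p q 0 x P Q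
    (fun y _ => arclength_dot_p_q y) I).
  fold q r in E; lra.
Qed.

(** Derivative of $\langle p, r\rangle + \langle q, q\rangle = 0$: one $\langle q, r\rangle$ comes
    from the first term and two from the second. *)
Lemma arclength_dot_p_s (x : R) : dot (p x) (s x) = - 3 * dot (q x) (r x).
Proof.
  destruct (arclength_derivatives x) as (_ & Dp & Dq & Dr & _).
  assert (D := is_derive_Rplus _ _ _ _ _
    (is_derive_dot _ _ _ _ _ Dp Dr) (is_derive_dot _ _ _ _ _ Dq Dq)).
  apply is_derive_unique in D.
  assert (E : Derive (fun y => dot (p y) (r y) + dot (q y) (q y)) x = 0).
  { rewrite (Derive_ext _ (fun _ => 0)); [apply Derive_const|].
    intros y; rewrite arclength_dot_p_r; ring. }
  pose proof (eq_trans (eq_sym D) E) as F.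
  rewrite (dot_comm (r x) (q x)) in F; lra.
Qed.

Lemma is_derive_filament_field (x : R) :
  is_derive (filament_field g) x (scal (1 / 2) (cross (p x) (r x))).
Proof.
  destruct (arclength_derivatives x) as (_ & Dp & Dq & _).
  apply (is_derive_eq _ _ _ _
    (is_derive_scal_const (1 / 2) _ _ _ (is_derive_cross _ _ _ _ _ Dp Dq))).
  apply R3_ext; comps; ring.
Qed.

Lemma is_derive2_filament_field (x : R) :
  is_derive (fun y => scal (1 / 2) (cross (p y) (r y))) x
    (scal (1 / 2) (plus (cross (q x) (r x)) (cross (p x) (s x)))).
Proof.
  destruct (arclength_derivatives x) as (_ & Dp & _ & Dr & _).
  exact (is_derive_scal_const (1 / 2) _ _ _ (is_derive_cross _ _ _ _ _ Dp Dr)).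
Qed.

Lemma is_derive3_filament_field (x : R) :
  is_derive
    (fun y => scal (1 / 2) (plus (cross (q y) (r y)) (cross (p y) (s y)))) x
    (scal (1 / 2) (plus (scal 2 (cross (q x) (s x))) (cross (p x) (w x)))).
Proof.
  destruct (arclength_derivatives x) as (_ & Dp & Dq & Dr & Ds).
  apply (is_derive_eq _ _ _ _
    (is_derive_scal_const (1 / 2) _ _ _ (@is_derive_plus _ _ _ _ _ _ _
      (is_derive_cross _ _ _ _ _ Dq Dr) (is_derive_cross _ _ _ _ _ Dp Ds)))).
  apply R3_ext; comps; ring.
Qed.

(** At unit speed $H = q$ and $\nabla^\perp_{e_0}H = r + |q|^2p$; the coefficient is $-\frac18 -
    \frac14 = -\frac38$. *)
Lemma normalized_airy_field_arclengthE (x : R) :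
  normalized_airy_field g x
  = plus (scal (- (3 / 8) * dot (q x) (q x)) (p x)) (scal (- (1 / 4)) (r x)).
Proof.
  destruct arclength_smooth as (G & _).
  rewrite (normalized_airy_field_jetE T g open_true G); [|intros y _|exact I].
  2:{ apply dot_pos_neq_0; fold p; rewrite arclength_dot_p_p; lra. }
  fold p q r; unfold airy_jet, nabla_perp_jet.
  replace (mean_curv_jet (p x) (q x)) with (q x).
  - change (norm (p x)) with (norm (vderive g x)).
    rewrite arclength_g, arclength_dot_p_q, (dot_comm (r x)), arclength_dot_p_r.
    rewrite !pow1, Rinv_1; apply R3_ext; comps; field.
  - unfold mean_curv_jet; rewrite arclength_dot_p_q.
    change (norm (p x)) with (norm (vderive g x)).
    rewrite arclength_g, !pow1, Rinv_1; apply R3_ext; comps; ring.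
Qed.

Lemma is_derive_normalized_airy_field (x : R) :
  is_derive (normalized_airy_field g) x
    (plus (plus (scal (- (3 / 4) * dot (q x) (r x)) (p x))
      (scal (- (3 / 8) * dot (q x) (q x)) (q x))) (scal (- (1 / 4)) (s x))).
Proof.
  destruct (arclength_derivatives x) as (_ & Dp & Dq & Dr & _).
  apply (is_derive_ext (fun y => plus (scal (- (3 / 8) * dot (q y) (q y)) (p y))
    (scal (- (1 / 4)) (r y)))).
  { intros y; symmetry; apply normalized_airy_field_arclengthE. }
  apply (is_derive_eq _ _ _ _ (@is_derive_plus _ _ _ _ _ _ _
    (is_derive_scal_R3 _ _ _ _ _
      (is_derive_scal _ _ (- (3 / 8)) _ (is_derive_dot _ _ _ _ _ Dq Dq)) Dp)
    (is_derive_scal_const (- (1 / 4)) _ _ _ Dr))).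
  rewrite (dot_comm (r x) (q x)); apply R3_ext; comps; field.
Qed.

Lemma is_derive2_normalized_airy_field (x : R) :
  is_derive (fun y => plus (plus (scal (- (3 / 4) * dot (q y) (r y)) (p y))
      (scal (- (3 / 8) * dot (q y) (q y)) (q y))) (scal (- (1 / 4)) (s y))) x
    (plus (plus (plus
      (scal (- (3 / 4) * (dot (r x) (r x) + dot (q x) (s x))) (p x))
      (scal (- (3 / 2) * dot (q x) (r x)) (q x)))
      (scal (- (3 / 8) * dot (q x) (q x)) (r x)))
      (scal (- (1 / 4)) (w x))).
Proof.
  destruct (arclength_derivatives x) as (_ & Dp & Dq & Dr & Ds).
  apply (is_derive_eq _ _ _ _ (@is_derive_plus _ _ _ _ _ _ _
    (@is_derive_plus _ _ _ _ _ _ _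
      (is_derive_scal_R3 _ _ _ _ _
        (is_derive_scal _ _ (- (3 / 4)) _ (is_derive_dot _ _ _ _ _ Dq Dr)) Dp)
      (is_derive_scal_R3 _ _ _ _ _
        (is_derive_scal _ _ (- (3 / 8)) _ (is_derive_dot _ _ _ _ _ Dq Dq)) Dq))
    (is_derive_scal_const (- (1 / 4)) _ _ _ Ds))).
  rewrite (dot_comm (r x) (q x)); apply R3_ext; comps; field.
Qed.

End Arclength.

(** * Vanishing of the bracket *)

Lemma airy_filament_commute :
  commute_on_arclength normalized_airy_field filament_field.
Proof.
  intros g Sg Ng.
  set (p := vderive g); set (q := vderive p); set (r := vderive q).
  set (s := vderive r); set (w := vderive s).
  pose (X1 := fun x => scal (1 / 2) (cross (p x) (r x)) : R3).
  pose (X2 := fun x =>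
    scal (1 / 2) (plus (cross (q x) (r x)) (cross (p x) (s x))) : R3).
  pose (X3 := fun x =>
    scal (1 / 2) (plus (scal 2 (cross (q x) (s x))) (cross (p x) (w x))) : R3).
  pose (Y1 := fun x => plus (plus (scal (- (3 / 4) * dot (q x) (r x)) (p x))
      (scal (- (3 / 8) * dot (q x) (q x)) (q x))) (scal (- (1 / 4)) (s x)) : R3).
  pose (Y2 := fun x => plus (plus (plus
      (scal (- (3 / 4) * (dot (r x) (r x) + dot (q x) (s x))) (p x))
      (scal (- (3 / 2) * dot (q x) (r x)) (q x)))
      (scal (- (3 / 8) * dot (q x) (q x)) (r x)))
      (scal (- (1 / 4)) (w x)) : R3).
  (* The witness is the variation of the filament field along the Airy field, read off from the
     bilinearity of $\frac12 p\times q$. *)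
  exists (fun x => scal (1 / 2) (plus (cross (Y1 x) (q x)) (cross (p x) (Y2 x)))).
  assert (D := arclength_derivatives g Sg); fold p q r s w in D.
  assert (V1 : forall (h h' : R -> R3) e, (forall y, is_derive h y (h' y)) ->
    forall y, vderive (fun y => plus (g y) (scal e (h y))) y
              = plus (p y) (scal e (h' y))).
  { intros h h' e H; apply vderive_plus_scal; [apply D | exact H]. }
  assert (V2 : forall (h h' h'' : R -> R3) e, (forall y, is_derive h y (h' y)) ->
    (forall y, is_derive h' y (h'' y)) ->
    forall y, vderive (vderive (fun y => plus (g y) (scal e (h y)))) y
              = plus (q y) (scal e (h'' y))).
  { intros h h' h'' e H H' y; rewrite (vderive_ext _ _ y (V1 h h' e H)).
    apply vderive_plus_scal; [apply D | exact H']. }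
  split; intros x.
  - assert (DX1 : forall y, is_derive (filament_field g) y (X1 y))
      by exact (is_derive_filament_field g Sg).
    assert (DX2 : forall y, is_derive X1 y (X2 y))
      by exact (is_derive2_filament_field g Sg).
    assert (DX3 : forall y, is_derive X2 y (X3 y))
      by exact (is_derive3_filament_field g Sg).
    refine (is_derive_eq _ 0 _ _ _ (airy_filament_bracket_identity
      (p x) (q x) (r x) (s x) (w x)
      (arclength_dot_p_p g Ng x) (arclength_dot_p_q g Sg Ng x)
      (arclength_dot_p_r g Sg Ng x) (arclength_dot_p_s g Sg Ng x))).
    fold (X1 x) (X2 x) (X3 x).
    assert (P0 : forall u z : R3, plus u (scal 0 z) = u)
      by (intros; apply R3_ext; comps; ring).
    (* The field of the perturbed curve is given by the jet formula only while the perturbed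
       velocity at [x] is nonzero, which holds for [e] near 0. *)
    apply (is_derive_ext_loc (fun e => airy_jet (plus (p x) (scal e (X1 x)))
      (plus (q x) (scal e (X2 x))) (plus (r x) (scal e (X3 x))))).
    + apply (filter_imp (fun e => 0 < dot (plus (p x) (scal e (X1 x)))
                                         (plus (p x) (scal e (X1 x))))).
      2:{ apply (open_dot_pos (fun e => plus (p x) (scal e (X1 x)))
            (fun _ => X1 x)).
          - intros e; apply is_derive_line.
          - rewrite P0; unfold p; rewrite (arclength_dot_p_p g Ng x); lra. }
      intros e He.
      pose (ge := fun y => plus (g y) (scal e (filament_field g y)) : R3).
      assert (W1 := V1 _ _ e DX1 : forall y, vderive ge y = _).
      assert (W2 := V2 _ _ _ e DX1 DX2 : forall y, vderive (vderive ge) y = _).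
      assert (W3 : forall y, vderive (vderive (vderive ge)) y
                             = plus (r y) (scal e (X3 y))).
      { intros y; rewrite (vderive_ext _ _ y W2).
        apply vderive_plus_scal; [apply D | exact DX3]. }
      (* For this fixed [e], the open set of parameters where the perturbed curve is immersed; it
         contains [x] by [He]. *)
      pose (U := fun y => 0 < dot (plus (p y) (scal e (X1 y)))
                                  (plus (p y) (scal e (X1 y)))).
      rewrite <- W1, <- W2, <- W3; symmetry.
      apply (normalized_airy_field_jetE U ge).
      * apply (open_dot_pos (fun y => plus (p y) (scal e (X1 y)))
          (fun y => plus (q y) (scal e (X2 y)))).
        intros y; destruct (D y) as (_ & Dp & _).
        exact (@is_derive_plus _ _ _ _ _ _ _ Dp
          (is_derive_scal_const e _ _ _ (DX2 y))).
      * apply (smooth_on_mono (fun _ => True)); [trivial|].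
        destruct (arclength_smooth g Sg) as (G & P & Q & _).
        apply smooth_on_plus; [exact open_true | exact G |].
        do 2 (apply smooth_on_scal;
          [exact open_true | intros n; apply Cn_const, open_true |]).
        now apply smooth_on_cross; [exact open_true | |].
      * intros y Hy; rewrite W1; now apply dot_pos_neq_0.
      * exact He.
    + apply (is_derive_airy_jet (fun e => plus (p x) (scal e (X1 x)))
        (fun e => plus (q x) (scal e (X2 x)))
        (fun e => plus (r x) (scal e (X3 x)))); try apply P0;
        try apply is_derive_line.
      * apply Ng.
      * apply (arclength_dot_p_q g Sg Ng).
      (* This and the next goal say that the filament field preserves the arc-length parameter to
         first order, by antisymmetry of the triple product. *)
      * unfold X1; coords; ring.
      * unfold X1, X2; coords; ring.
  - assert (DY1 : forall y, is_derive (normalized_airy_field g) y (Y1 y))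
      by exact (is_derive_normalized_airy_field g Sg Ng).
    assert (DY2 : forall y, is_derive Y1 y (Y2 y))
      by exact (is_derive2_normalized_airy_field g Sg).
    (* The filament field does not divide by the speed, so its expression along the perturbed curve
       is valid for every [e]. *)
    apply (is_derive_ext (fun e => scal (1 / 2)
      (cross (plus (p x) (scal e (Y1 x))) (plus (q x) (scal e (Y2 x)))))).
    + intros e; unfold filament_field.
      rewrite (V1 _ _ e DY1), (V2 _ _ _ e DY1 DY2); reflexivity.
    + apply (is_derive_eq _ _ _ _ (is_derive_scal_const (1 / 2) _ _ _
        (is_derive_cross _ _ _ _ _ (is_derive_line (p x) (Y1 x) 0)
          (is_derive_line (q x) (Y2 x) 0)))).
      apply R3_ext; comps; ring.
Qed.

Theorem theorem7p4 :
  (forall g : R -> R -> R3,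
     (forall t : R, periodic (fun x => g x t)) ->
     smooth2 m_infty p_infty m_infty p_infty g ->
     (forall t : R, immersed_on m_infty p_infty (fun x => g x t)) ->
     solves_flow airy_field m_infty p_infty m_infty p_infty g ->
     forall t t' : R,
       closed_length (fun x => g x t) = closed_length (fun x => g x t'))
  /\
  (forall (a b t0 t1 : Rbar) (g : R -> R -> R3),
     smooth2 a b t0 t1 g ->
     (forall t : R, in_itv t0 t1 t -> immersed_on a b (fun x => g x t)) ->
     solves_flow normalized_airy_field a b t0 t1 g ->
     forall x t t' : R, in_itv a b x -> in_itv t0 t1 t -> in_itv t0 t1 t' ->
       norm (vderive (fun y => g y t) x) = norm (vderive (fun y => g y t') x))
  /\
  commute_on_arclength normalized_airy_field filament_field.
Proof.
  split; [|split].
  - exact airy_flow_preserves_length.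
  - exact normalized_airy_flow_preserves_speed.
  - exact airy_filament_commute.
Qed.
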